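(* Let $X$ be a connected topological space admitting a universal covering space $\widetilde{X}$ and let $p : \zeta \to X$ be a group bundle with discrete fibres. Then there exist a discrete group $\Gamma$, a group morphism $\varphi : \pi_1 X \to \mathrm{Aut}(\Gamma)$ and an isomorphism of group coverings $\zeta \simeq \pi_1 X \backslash (\widetilde{X}\times\Gamma)$, where $f \in \pi_1 X$ acts to the left on $(\xi,\gamma)\in\widetilde{X}\times\Gamma$ via $\tau_f(\xi,\gamma) := (f(\xi),\varphi_f(\gamma))$. Moreover, if $\varphi$ and $\varphi'$ are group morphisms from $\pi_1X$ to $\mathrm{Aut}(\Gamma)$, then the associated group coverings $\zeta$ and $\zeta'$ (the quotients of $\widetilde{X}\times\Gamma$ by the left actions of $\pi_1X$ under which $f\in\pi_1X$ sends $(\xi,\gamma)$ to $(f(\xi),\varphi_f(\gamma))$ and to $(f(\xi),\varphi'_f(\gamma))$, respectively) are isomorphic over $X$ if and only if $\varphi$ and $\varphi'$ are conjugate under the action of $\mathrm{Aut}(\Gamma)$ on $\mathrm{Hom}(\pi_1X,\mathrm{Aut}(\Gamma))$ defined, for all $\lambda\in\mathrm{Aut}(\Gamma)$ and all $f\in\pi_1X$, by $(\lambda\bullet\varphi)_f := \lambda\circ\varphi_f\circ\lambda^{-1}$. So the set of isomorphism classes of $(\pi_1X,\Gamma)$-group coverings of $X$ is in bijection with the group cohomology set $$H^1\big(\pi_1X,\mathrm{Aut}(\Gamma)\big) := \mathrm{Aut}(\Gamma)\,\backslash\,\mathrm{Hom}\big(\pi_1X,\mathrm{Aut}(\Ga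mma)\big).$$
   Context: A group bundle with discrete fibres on a topological space $X$, also called a group covering, is a topological space $\zeta$ with a continuous map $p : \zeta\to X$ whose fibres are discrete groups, such that every $x\in X$ has an open neighbourhood $U$ with a homeomorphism $p^{-1}(U)\simeq U\times p^{-1}(x)$ over $U$ that is a group isomorphism on each fibre. An isomorphism of group coverings is a homeomorphism over $X$ that is a group isomorphism on each fibre. The universal covering $q:\widetilde{X}\to X$ is simply connected (and connected), and $\pi_1X$ is identified with its automorphism group $\mathrm{Aut}_X(\widetilde{X})$, acting on $\widetilde{X}$ to the left; $\varphi_f$ denotes the image of $f$ under $\varphi$. A $(\pi_1X,\Gamma)$-group covering is a group covering $\zeta$ of $X$ such that $q^*\zeta\simeq\widetilde{X}\times\Gamma$ as group coverings of $\widetilde{X}$. *)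

(* Defs.v *)
From HB Require Import structures.
From mathcomp Require Import all_boot all_order all_algebra.
From mathcomp Require Import all_classical all_reals all_analysis.

Set Implicit Arguments.
Unset Strict Implicit.
Unset Printing Implicit Defensive.

Local Open Scope classical_set_scope.
Local Open Scope quotient_scope.
Local Open Scope group_scope.

Definition homeomorphism (S T : topologicalType) (h : S -> T) : Prop :=
  continuous h /\
  exists g : T -> S, [/\ cancel h g, cancel g h & continuous g].

(* Subsets are turned into spaces through [set_type], whose topology is the
   subset topology. *)
Definition fibre (E X : topologicalType) (p : E -> X) (x : X) :
  topologicalType := set_type (p @^-1` [set x]).

Definition discrete_fibres (E X : topologicalType) (p : E -> X) : Prop :=
  forall (x : X) (e : fibre p x), open [set e].

Definition trivialization (E X : topologicalType) (p : E -> X) (x : X)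
    (U : set X) (h : set_type (p @^-1` U) -> set_type U * fibre p x) : Prop :=
  homeomorphism h /\ forall z, val (h z).1 = p (val z).

Definition covering (E X : topologicalType) (p : E -> X) : Prop :=
  [/\ continuous p, discrete_fibres p &
    forall x : X, exists U : set X, [/\ open U, U x &
      exists h : set_type (p @^-1` U) -> set_type U * fibre p x,
        trivialization h]].

Definition trivial_covering (E X : topologicalType) (p : E -> X) : Prop :=
  exists (F : discreteTopologicalType) (h : E -> X * F),
    homeomorphism h /\ forall z, (h z).1 = p z.

(* Simple connectedness in the sense of covering theory, which is the notion
   that makes sense without local path-connectedness assumptions: a space all
   of whose coverings are trivial. *)
Definition simply_connected (Y : topologicalType) : Prop :=
  forall (E : topologicalType) (p : E -> Y), covering p -> trivial_covering p.

Definition universal_covering (Xt X : topologicalType) (q : Xt -> X) : Prop :=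
  [/\ covering q, [set: Xt] !=set0, connected [set: Xt] &
      simply_connected Xt].

(* Spaces over [X] with a law on each fibre. The law is encoded as a total
   binary operation on the total space; only its values on pairs of points of a
   same fibre are meaningful, and only those are used below. *)
Record fibred_magma (X : topologicalType) := FibredMagma {
  total_space :> topologicalType;
  bproj : total_space -> X;
  fmul : total_space -> total_space -> total_space
}.

(* The group carried by a fibre is determined by its law, so that being a group
   is expressed as the existence of a group whose law is transported to it. *)
Definition fibres_are_groups (X : topologicalType) (z : fibred_magma X) :
    Prop :=
  forall x : X, exists (G : groupType) (i : G -> fibre (@bproj X z) x),
    bijective i /\
    forall g h : G, val (i (g * h)) = fmul (val (i g)) (val (i h)).

Definition group_covering (X : topologicalType) (z : fibred_magma X) : Prop :=
  [/\ continuous (@bproj X z), discrete_fibres (@bproj X z),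
      fibres_are_groups z &
    forall x : X, exists U : set X, [/\ open U, U x &
      exists h : set_type (@bproj X z @^-1` U) ->
                 set_type U * fibre (@bproj X z) x,
        trivialization h /\
        forall a b c, bproj (val a) = bproj (val b) ->
          val c = fmul (val a) (val b) ->
          val (h c).2 = fmul (val (h a).2) (val (h b).2)]].

Definition covering_iso (X : topologicalType) (z z' : fibred_magma X) : Prop :=
  exists f : z -> z', [/\ homeomorphism f,
    forall a, bproj (f a) = bproj a &
    forall a b, bproj a = bproj b -> f (fmul a b) = fmul (f a) (f b)].

Section Pullback.
Variables (Y X : topologicalType) (q : Y -> X) (z : fibred_magma X).

Definition pullback_space : topologicalType :=
  set_type [set u : Y * z | q u.1 = bproj u.2].

Definition pullback_proj (u : pullback_space) : Y := (val u).1.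

(* When [u] and [v] lie in the same fibre the pair belongs to the pullback and
   [insubd] does not return its default value. *)
Definition pullback_mul (u v : pullback_space) : pullback_space :=
  insubd u ((val u).1, fmul (val u).2 (val v).2).

Definition pullback : fibred_magma Y := FibredMagma pullback_proj pullback_mul.

End Pullback.

Definition trivial_bundle (Y : topologicalType) (Gam : groupType) :
    fibred_magma Y :=
  @FibredMagma Y (Y * discrete_topology Gam)%type fst
    (fun u v => (u.1, (u.2 : Gam) * (v.2 : Gam))).

Section Deck.
Variables (Xt X : topologicalType) (q : Xt -> X).

Definition deck : Type :=
  set_type [set f : Xt -> Xt | homeomorphism f /\ forall xi, q (f xi) = q xi].

HB.instance Definition _ := Choice.on deck.

Definition deck_fun (f : deck) : Xt -> Xt := val f.

Lemma deckP (f : deck) :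
  homeomorphism (deck_fun f) /\ forall xi, q (deck_fun f xi) = q xi.
Proof. exact: set_valP f. Qed.

Lemma deck_eqP (f g : deck) : deck_fun f =1 deck_fun g -> f = g.
Proof. by move=> fg; apply: val_inj; apply/funext. Qed.

Lemma deck_one_subproof :
  homeomorphism (@id Xt) /\ forall xi, q (id xi) = q xi.
Proof. by split=> //; split; [|exists id; split]; move=> //= x; exact: cvg_id. Qed.

Lemma deck_mul_subproof (f g : deck) :
  homeomorphism (deck_fun f \o deck_fun g) /\
  forall xi, q ((deck_fun f \o deck_fun g) xi) = q xi.
Proof.
have [[cf [f' [ff' f'f cf']]] qf] := deckP f.
have [[cg [g' [gg' g'g cg']]] qg] := deckP g.
split; last by move=> xi /=; rewrite qf qg.
split; first by move=> x; apply: continuous_comp; [exact: cg|exact: cf].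
exists (g' \o f'); split; [exact: can_comp|exact: can_comp|].
by move=> x; apply: continuous_comp; [exact: cf'|exact: cg'].
Qed.

Lemma deck_inv_subproof (f : deck) : {g : Xt -> Xt |
  (homeomorphism g /\ forall xi, q (g xi) = q xi) /\
  cancel (deck_fun f) g /\ cancel g (deck_fun f)}.
Proof.
apply: cid; have [[cf [g [fg gf cg]]] qf] := deckP f.
exists g; split=> //; split; first by split=> //; exists (deck_fun f); split.
by move=> xi; rewrite -qf gf.
Qed.

Definition deck_one : deck := SigSub (mem_set deck_one_subproof).
Definition deck_mul (f g : deck) : deck :=
  SigSub (mem_set (deck_mul_subproof f g)).
Definition deck_inv (f : deck) : deck :=
  SigSub (mem_set (svalP (deck_inv_subproof f)).1).

Lemma deck_mulA : associative deck_mul.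
Proof. by move=> f g h; apply: deck_eqP. Qed.
Lemma deck_mul1 : left_id deck_one deck_mul.
Proof. by move=> f; apply: deck_eqP. Qed.
Lemma deck_mulr1 : right_id deck_one deck_mul.
Proof. by move=> f; apply: deck_eqP. Qed.
Lemma deck_mulV : left_inverse deck_one deck_inv deck_mul.
Proof.
by move=> f; apply: deck_eqP => x; exact: (svalP (deck_inv_subproof f)).2.1.
Qed.
Lemma deck_mulrV : right_inverse deck_one deck_inv deck_mul.
Proof.
by move=> f; apply: deck_eqP => x; exact: (svalP (deck_inv_subproof f)).2.2.
Qed.

(* The product is composition, so that [deck] acts on [Xt] on the left. When
   [q] is a universal covering, this group is the fundamental group of [X]. *)
HB.instance Definition _ := isGroup.Build deck
  deck_mulA deck_mul1 deck_mulr1 deck_mulV deck_mulrV.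

End Deck.

Section GroupAut.
Variable Gam : groupType.

Definition autg : Type :=
  set_type [set f : Gam -> Gam | bijective f /\ {morph f : x y / x * y}].

HB.instance Definition _ := Choice.on autg.

Definition autg_fun (f : autg) : Gam -> Gam := val f.

Lemma autgP (f : autg) :
  bijective (autg_fun f) /\ {morph autg_fun f : x y / x * y}.
Proof. exact: set_valP f. Qed.

Lemma autg_eqP (f g : autg) : autg_fun f =1 autg_fun g -> f = g.
Proof. by move=> fg; apply: val_inj; apply/funext. Qed.

Lemma autg_one_subproof : bijective (@id Gam) /\ {morph (@id Gam) : x y / x * y}.
Proof. by split=> //; exists id. Qed.

Lemma autg_mul_subproof (f g : autg) :
  bijective (autg_fun f \o autg_fun g) /\
  {morph (autg_fun f \o autg_fun g) : x y / x * y}.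
Proof.
have [bf mf] := autgP f; have [bg mg] := autgP g.
by split; [exact: bij_comp|move=> x y /=; rewrite mg mf].
Qed.

Lemma autg_inv_subproof (f : autg) : {g : Gam -> Gam |
  (bijective g /\ {morph g : x y / x * y}) /\
  cancel (autg_fun f) g /\ cancel g (autg_fun f)}.
Proof.
apply: cid; have [[g fg gf] mf] := autgP f.
exists g; split=> //; split; first by exists (autg_fun f).
by move=> x y; apply: (can_inj fg); rewrite mf !gf.
Qed.

Definition autg_one : autg := SigSub (mem_set autg_one_subproof).
Definition autg_mul (f g : autg) : autg :=
  SigSub (mem_set (autg_mul_subproof f g)).
Definition autg_inv (f : autg) : autg :=
  SigSub (mem_set (svalP (autg_inv_subproof f)).1).

Lemma autg_mulA : associative autg_mul.
Proof. by move=> f g h; apply: autg_eqP. Qed.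
Lemma autg_mul1 : left_id autg_one autg_mul.
Proof. by move=> f; apply: autg_eqP. Qed.
Lemma autg_mulr1 : right_id autg_one autg_mul.
Proof. by move=> f; apply: autg_eqP. Qed.
Lemma autg_mulV : left_inverse autg_one autg_inv autg_mul.
Proof.
by move=> f; apply: autg_eqP => x; exact: (svalP (autg_inv_subproof f)).2.1.
Qed.
Lemma autg_mulrV : right_inverse autg_one autg_inv autg_mul.
Proof.
by move=> f; apply: autg_eqP => x; exact: (svalP (autg_inv_subproof f)).2.2.
Qed.

HB.instance Definition _ := isGroup.Build autg
  autg_mulA autg_mul1 autg_mulr1 autg_mulV autg_mulrV.

End GroupAut.

Section Conjugation.
Variables (P Gam : groupType).

Definition conj_fun (lam : autg Gam) (phi : {multiplicative P -> autg Gam})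
  (f : P) : autg Gam := lam * phi f * lam^-1.

Lemma conj_funM lam phi : {morph conj_fun lam phi : f g / f * g}.
Proof. by move=> f g; rewrite /conj_fun gmulfM !mulgA mulgVK. Qed.

HB.instance Definition _ lam phi :=
  isMultiplicative.Build P (autg Gam) (conj_fun lam phi) (conj_funM lam phi).

Definition conj_hom (lam : autg Gam) (phi : {multiplicative P -> autg Gam}) :
  {multiplicative P -> autg Gam} := conj_fun lam phi.

Definition conjugate (phi phi' : {multiplicative P -> autg Gam}) : Prop :=
  exists lam : autg Gam, phi' =1 conj_hom lam phi.

Definition hom_orbit (phi : {multiplicative P -> autg Gam}) :
  set {multiplicative P -> autg Gam} := [set phi' | conjugate phi phi'].

(* Aut(Gam) \ Hom(P, Aut(Gam)), as the set of all orbits *)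
Definition H1 : set (set {multiplicative P -> autg Gam}) := range hom_orbit.

End Conjugation.

Arguments H1 : clear implicits.

Section Associated.
Variables (Xt X : topologicalType) (q : Xt -> X) (Gam : groupType).
Variable phi : {multiplicative deck q -> autg Gam}.

Local Notation XG := (Xt * discrete_topology Gam)%type.

Definition tau (f : deck q) (u : XG) : XG :=
  (deck_fun f u.1, autg_fun (phi f) (u.2 : Gam)).

Lemma tau1 u : tau 1 u = u.
Proof.
have phi1 : phi 1 = 1 by apply: (mulgI (phi 1)); rewrite -gmulfM !mulg1.
by case: u => xi g; rewrite /tau /= phi1.
Qed.

Lemma tauM f g u : tau (f * g) u = tau f (tau g u).
Proof. by rewrite /tau /= gmulfM. Qed.

Definition tau_rel : rel XG := fun u v => `[< exists f, v = tau f u >].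

Lemma tau_rel_refl : reflexive tau_rel.
Proof. by move=> u; apply/asboolP; exists 1; rewrite tau1. Qed.

Lemma tau_rel_sym : symmetric tau_rel.
Proof.
by move=> u v; apply/asboolP/asboolP => -[f ->]; exists f^-1;
  rewrite -tauM mulVg tau1.
Qed.

Lemma tau_rel_trans : transitive tau_rel.
Proof.
move=> v u w /asboolP[f ->] /asboolP[g ->].
by apply/asboolP; exists (g * f); rewrite tauM.
Qed.

Canonical tau_equiv := EquivRel tau_rel tau_rel_refl tau_rel_sym tau_rel_trans.

Definition assoc_space : topologicalType :=
  quotient_topology {eq_quot tau_equiv}.

Definition assoc_class (u : XG) : assoc_space :=
  \pi_{eq_quot tau_equiv} u.

Definition assoc_proj (a : assoc_space) : X :=
  q (repr (a : {eq_quot tau_equiv})).1.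

(* The law is [xi, g] * [xi, h] = [xi, g * h]. When [q] is a universal covering,
   two classes in a same fibre have representatives with the same first
   component, and the result does not depend on their choice; the default value
   [a] is only taken for points of different fibres. *)
Definition assoc_mul (a b : assoc_space) : assoc_space :=
  xget a [set c | exists (xi : Xt) (g h : Gam),
    [/\ a = assoc_class (xi, g), b = assoc_class (xi, h) &
        c = assoc_class (xi, g * h)]].

Definition associated : fibred_magma X := FibredMagma assoc_proj assoc_mul.

End Associated.

Section Classes.
Variables (Xt X : topologicalType) (q : Xt -> X) (Gam : groupType).

Definition pi1_group_covering (z : fibred_magma X) : Prop :=
  group_covering z /\ covering_iso (pullback q z) (trivial_bundle Xt Gam).

(* Group coverings of [X] form a large type, on which [set] cannot be used for
   universe reasons: their classes are plain predicates. *)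
Definition iso_class (z : fibred_magma X) : fibred_magma X -> Prop :=
  fun z' => pi1_group_covering z' /\ covering_iso z z'.

Definition is_iso_class (C : fibred_magma X -> Prop) : Prop :=
  exists z : fibred_magma X, pi1_group_covering z /\ C = iso_class z.

End Classes.

(* Main.v *)
Require Import Defs.
From HB Require Import structures.
From mathcomp Require Import all_boot all_order all_algebra.
From mathcomp Require Import all_classical all_reals all_analysis.

Local Open Scope classical_set_scope.

(** Write [q : Xt -> X] for the universal covering and [z] for a group covering
    of [X]. Everything is expressed through the families of lifts
    [m : Xt -> Gam -> z] of [q] that restrict, over each [xi], to a group
    isomorphism of [Gam] onto the fibre of [z] over [q xi] ([fibre_param]).

    Two facts about coverings carry the proof. A lift of [q] to a covering is
    determined by one value, since [Xt] is connected ([lift_unique]), and a lift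
    with a prescribed value exists, since the pullback of the covering to [Xt]
    is trivial ([simply_connected_lift]). Applied to [q] itself they show that
    the deck group acts simply transitively on the fibres of [q]
    ([deck_free], [deck_transitive]). Applied to [z], they propagate a group
    structure on one fibre to a parametrization ([param_of_group_covering]), and
    show that two parametrizations of [z] by the same group differ by one
    automorphism of that group, constant over [Xt] ([param_unique]).

    This uniqueness gives the action: for a deck transformation [f], the
    translate [m \o f^-1] is another parametrization, hence differs from [m] by
    an automorphism [phi f], and [phi] is a morphism ([param_equivariant]). The
    equivariant map [m] then factors through an isomorphism from the quotient of [Xt * Gam] to
    [z] ([associated_iso_of_param]). The quotient has a tautological
    parametrization [assoc_param], equivariant for its own [phi], so that an
    isomorphism between the coverings associated with [phi] and [phi'] yields two
    parametrizations of the latter, equivariant for [phi] and [phi']; the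
    automorphism comparing them conjugates [phi] to [phi']
    ([associated_iso_conjugate]). Finally, a parametrization by a given [Gam] is
    the same thing as an isomorphism of [q^* z] with the trivial bundle
    ([trivial_iso_of_param], [param_of_trivial_iso]), so the
    [(pi_1 X, Gam)]-coverings are, up to isomorphism, the associated ones.

    That the isomorphisms so obtained are homeomorphisms comes from one remark:
    a continuous bijection over a base, from a space open over it to one locally
    injective over it, is a homeomorphism ([homeomorphism_over]). *)

Set Implicit Arguments.
Unset Strict Implicit.
Unset Printing Implicit Defensive.

Local Open Scope group_scope.

(** * Continuity on products and subspaces *)

Lemma continuous_pair (R S T : topologicalType) (f : R -> S) (g : R -> T) x :
  {for x, continuous f} -> {for x, continuous g} ->
  {for x, continuous (fun y => (f y, g y))}.
Proof. by move=> cf cg; exact: (cvg_pair cf cg). Qed.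

Lemma continuous_of_fibrewise (Y Z : topologicalType) (D : choiceType)
    (k : Y * discrete_topology D -> Z) :
  (forall d, continuous (fun y => k (y, d))) -> continuous k.
Proof.
move=> ck [y d].
have N : \forall u \near (y, d : discrete_topology D), u.2 = d.
  by apply: (@cvg_snd _ _ _ _ _ [set d]); exact: discrete_set1.
have c : {for (y, d),
    continuous (fun u : Y * discrete_topology D => k (u.1, d))}.
  apply: (@continuous_comp (Y * discrete_topology D)%type Y Z fst
    (fun y => k (y, d))); [exact: cvg_fst | exact: ck].
apply: cvg_trans c; apply: near_eq_cvg.
by apply: filterS N => -[? ?] /= ->.
Qed.

Section SetType.
Variables (T : topologicalType) (A : set T).

Lemma set_val_continuous : continuous (val : set_type A -> T).
Proof. exact: initial_continuous. Qed.

Lemma continuous_set_type (S : topologicalType) (f : S -> set_type A) :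
  continuous (val \o f) -> continuous f.
Proof. exact: continuous_comp_initial. Qed.

Lemma set_type_lift a : A a -> exists z : set_type A, val z = a.
Proof. by move=> Aa; exists (SigSub (mem_set Aa)). Qed.

Lemma near_set_val (x : set_type A) (P : set T) :
  (\forall a \near val x, P a) -> \forall y \near x, P (val y).
Proof. exact: set_val_continuous. Qed.

Lemma near_open_set_val (x : set_type A) (P : set T) : open A ->
  (\forall y \near x, P (val y)) -> \forall a \near val x, P a.
Proof.
move=> oA [_ [[W oW <-]] Wx WP].
have : nbhs (val x) (W `&` A).
  by apply: open_nbhs_nbhs; split; [exact: openI | split=> //; exact: (set_valP x)].
apply: filterS => a [+ /set_type_lift[y ya]]; rewrite -ya => Wy; exact: WP.
Qed.

End SetType.

(** * Local trivializations *)

(** A local trivialization of [p] over [U] with discrete fibre [D], in terms of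
    total functions on the ambient types: [r] is the fibre coordinate and
    [s y e] the point over [y] of coordinate [e]. Dependent types are thus
    confined to the passage to and from [trivialization]. Coordinates are taken
    in a subset [D] of a type [F] so that [D] may be a fibre of [p], possibly
    empty. *)
Record chart (E X : topologicalType) (p : E -> X) (F : Type) (U : set X)
    (D : set F) (r : E -> F) (s : X -> F -> E) : Prop := Chart {
  chart_open : open U;
  chart_proj : forall y e, U y -> D e -> p (s y e) = y;
  chart_sectK : forall y e, U y -> D e -> r (s y e) = e;
  chart_dom : forall a, U (p a) -> D (r a);
  chart_coordK : forall a, U (p a) -> s (p a) (r a) = a;
  chart_near : forall a, U (p a) -> \forall b \near a, r b = r a;
  chart_cvg : forall y e, U y -> D e -> s ^~ e @ y --> s y e
}.

Section Charts.
Variables (E X : topologicalType) (p : E -> X).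

Lemma chart_of_trivialization (U : set X) (x : X) h :
  continuous p -> discrete_fibres p -> open U -> U x ->
  @trivialization E X p x U h ->
  exists (r : E -> E) (s : X -> E -> E),
    chart p U (p @^-1` [set x]) r s /\ forall z, r (val z) = val (h z).2.
Proof.
move=> cp dp oU Ux [[ch [g [hg gh cg]]] ph].
(* Outside the domains of [h] and of its inverse any value will do. *)
pose r a := match pselect (U (p a)) with
  | left H => val (h (SigSub (mem_set H : a \in p @^-1` U))).2
  | right _ => a end.
pose s y e := match pselect (U y), pselect (p e = x) with
  | left H, left H' =>
    val (g (SigSub (mem_set H), SigSub (mem_set H' : e \in p @^-1` [set x])))
  | _, _ => e end.
have rE (z : set_type (p @^-1` U)) : r (val z) = val (h z).2.
  rewrite /r; case: pselect => [H|]; last by case; exact: (set_valP z).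
  by congr (val (h _).2); exact: val_inj.
have sE (y : set_type U) (e : fibre p x) : s (val y) (val e) = val (g (y, e)).
  rewrite /s; case: pselect => [H|]; last by case; exact: (set_valP y).
  case: pselect => [H'|]; last by case; exact: (set_valP e).
  by congr (val (g (_, _))); exact: val_inj.
have liftE a : U (p a) -> exists z : set_type (p @^-1` U), val z = a.
  exact: set_type_lift.
have liftF e : p e = x -> exists z : fibre p x, val z = e.
  exact: set_type_lift.
exists r, s; split=> //; split=> //.
- move=> _ _ /set_type_lift[y <-] /liftF[e <-].
  by rewrite sE -ph gh.
- move=> _ _ /set_type_lift[y <-] /liftF[e <-].
  by rewrite sE rE gh.
- by move=> _ /liftE[z <-]; rewrite rE; exact: (set_valP (h z).2).
- move=> _ /liftE[z <-].
  by rewrite rE -ph sE -surjective_pairing hg.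
- move=> _ /liftE[z <-].
  have : \forall w \near z, (h w).2 = (h z).2.
    have : {for z, continuous (snd \o h)}.
      by apply: continuous_comp; [exact: ch | exact: cvg_snd].
    move/(_ [set (h z).2]); apply; apply: open_nbhs_nbhs.
    by split=> //; exact: dp.
  move=> hz; apply: (near_open_set_val (P := [set a | r a = r (val z)])).
    by move/continuousP: cp; exact.
  apply: filterS hz => w hw; rewrite /= !rE; exact: (congr1 val hw).
- move=> _ _ /set_type_lift[y <-] /liftF[e <-].
  have c : {for y, continuous (fun y' => val (g (y', e)))}.
    have c1 : {for y, continuous (fun y' : set_type U => (y', e))}.
      by apply: continuous_pair; [exact: cvg_id | exact: cst_continuous].
    apply: (@continuous_comp _ _ _ _ (fun u => val (g u)) y c1).
    by apply: (@continuous_comp _ _ _ g val);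
      [exact: cg | exact: set_val_continuous].
  move=> W /=; rewrite sE => nW.
  have gW : \forall y' \near y, W (val (g (y', e))) by exact: c.
  apply: (near_open_set_val (P := fun a => W (s a (val e)))) => //.
  by apply: filterS gW => y' /=; rewrite sE.
Qed.

Lemma trivialization_of_chart (F : Type) (U : set X) (D : set F) r s (x : X) :
  continuous p -> chart p U D r s -> U x ->
  exists h : set_type (p @^-1` U) -> set_type U * fibre p x,
    trivialization h /\ forall z, val (h z).2 = s x (r (val z)).
Proof.
move=> cp ch Ux.
have UP (z : set_type (p @^-1` U)) : U (p (val z)) by exact: (set_valP z).
have UV (y : set_type U) : U (val y) by exact: (set_valP y).
have DP (e : fibre p x) : D (r (val e)).
  by apply: (chart_dom ch); rewrite (set_valP e).
have DU (z : set_type (p @^-1` U)) : D (r (val z)).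
  exact: (chart_dom ch (UP z)).
have fibP (z : set_type (p @^-1` U)) : (p @^-1` [set x]) (s x (r (val z))).
  exact: (chart_proj ch Ux (DU z)).
have totP (u : set_type U * fibre p x) :
    (p @^-1` U) (s (val u.1) (r (val u.2))).
  by exact: (eq_ind_r U (UV u.1) (chart_proj ch (UV u.1) (DP u.2))).
pose h (z : set_type (p @^-1` U)) : set_type U * fibre p x :=
  (SigSub (mem_set (UP z)), SigSub (mem_set (fibP z))).
pose g u : set_type (p @^-1` U) := SigSub (mem_set (totP u)).
exists h; split=> //; split=> //; split; last first.
  exists g; split.
  - move=> z; apply: val_inj.
    by rewrite /= (chart_sectK ch Ux (DU z)) (chart_coordK ch (UP z)).
  - case=> y e; congr (_, _); apply: val_inj => /=.
      by exact: (chart_proj ch (UV y) (DP e)).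
    rewrite (chart_sectK ch (UV y) (DP e)).
    by rewrite -{1}(set_valP e : p (val e) = x) (chart_coordK ch) // (set_valP e).
  - apply: continuous_set_type => -[y e].
    pose B : topologicalType := (set_type U * fibre p x)%type.
    have c : {for (y, e), continuous (fun u : B => s (val u.1) (r (val e)))}.
      apply: (@continuous_comp _ _ _ (fun u : B => val u.1) (s ^~ (r (val e)))).
        by apply: continuous_comp; [exact: cvg_fst | exact: set_val_continuous].
      by exact: (chart_cvg ch (UV y) (DP e)).
    apply: cvg_trans c; apply: near_eq_cvg.
    have : \forall u \near (y, e), r (val u.2) = r (val e).
      apply: (@cvg_snd _ _ _ _ _
        [set e' : fibre p x | r (val e') = r (val e)]).
      apply: (@near_set_val _ _ e [set a | r a = r (val e)]).
      by apply: (chart_near ch); rewrite (set_valP e).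
    by apply: filterS => u /= ->.
move=> z; apply: continuous_pair.
  apply: continuous_set_type => {}z.
  by apply: continuous_comp; [exact: set_val_continuous|exact: cp].
pose k (w : set_type (p @^-1` U)) : fibre p x := SigSub (mem_set (fibP w)).
rewrite /h; suff : \forall w \near z, k w = k z.
  move=> kz W /nbhs_singleton Wz.
  apply: (filterS (P := [set w | k w = k z])) kz => w kw.
  by rewrite /= -/(k w) kw.
have : \forall w \near z, r (val w) = r (val z).
  apply: (@near_set_val _ _ _ [set a | r a = r (val z)]).
  exact: (chart_near ch).
by apply: filterS => w rw; apply: val_inj; rewrite /= rw.
Qed.

Lemma discrete_fibres_of_charts :
  (forall x, exists (F : Type) U (D : set F) r s, U x /\ chart p U D r s) ->
  discrete_fibres p.
Proof.
move=> chs x e; have [F [U [D [r [s [Ux ch]]]]]] := chs x.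
have pe (e' : fibre p x) : p (val e') = x by exact: (set_valP e').
rewrite openE => _ ->; rewrite /interior.
have : \forall e' \near e, r (val e') = r (val e).
  apply: (@near_set_val _ _ _ [set a | r a = r (val e)]).
  by apply: (chart_near ch); rewrite pe.
have fibE (e' : fibre p x) : s x (r (val e')) = val e'.
  have Ue : U (p (val e')) by rewrite pe.
  by have := chart_coordK ch Ue; rewrite pe.
by apply: filterS => e' re; apply: val_inj; rewrite /= -fibE re fibE.
Qed.

Lemma covering_of_charts : continuous p ->
  (forall x, exists (F : Type) U (D : set F) r s, U x /\ chart p U D r s) ->
  covering p.
Proof.
move=> cp chs; split=> //; first exact: discrete_fibres_of_charts.
move=> x; have [F [U [D [r [s [Ux ch]]]]]] := chs x.
have [h [th _]] := trivialization_of_chart cp ch Ux.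
by exists U; split; [exact: chart_open ch| |exists h].
Qed.

Lemma covering_chart : covering p -> forall x,
  exists U (r : E -> E) s, U x /\ chart p U (p @^-1` [set x]) r s.
Proof.
move=> [cp dp tp] x; have [U [oU Ux [h th]]] := tp x.
have [r [s [ch _]]] := chart_of_trivialization cp dp oU Ux th.
by exists U, r, s.
Qed.

Lemma covering_continuous : covering p -> continuous p.
Proof. by case. Qed.

End Charts.

(** * Coverings: openness, lifts and pullbacks *)

Definition open_map (S T : topologicalType) (f : S -> T) :=
  forall (a : S) (W : set S), nbhs a W -> nbhs (f a) (f @` W).

Definition locally_injective (S T : topologicalType) (f : S -> T) :=
  forall a : S, exists2 W : set S, nbhs a W & {in W &, injective f}.

Lemma fst_open_map (S T : topologicalType) : open_map (@fst S T).
Proof.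
move=> a W; rewrite nbhsE => -[V [oV Va] VW].
apply: (@filterS _ _ _ (fst @` V)); first exact: image_subset.
by apply: open_nbhs_nbhs; split; [exact: fst_open | exists a].
Qed.

Section CoveringTheory.
Variables (E X : topologicalType) (p : E -> X).
Hypothesis covp : covering p.

Lemma covering_locally_injective : locally_injective p.
Proof.
move=> a; have [U [r [s [Ua ch]]]] := covering_chart covp (p a).
exists (p @^-1` U `&` [set b | r b = r a]).
  apply: filterI; last exact: (chart_near ch).
  apply: (covering_continuous covp); apply: open_nbhs_nbhs.
  by split=> //; exact: (chart_open ch).
move=> b c /set_mem[/= Ub rb] /set_mem[/= Uc rc] pbc.
by rewrite -(chart_coordK ch Ub) -(chart_coordK ch Uc) pbc rb rc.
Qed.

Lemma covering_open_map : open_map p.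
Proof.
move=> a W Wa; have [U [r [s [Ua ch]]]] := covering_chart covp (p a).
have cs := chart_cvg ch Ua (chart_dom ch Ua).
rewrite (chart_coordK ch Ua) in cs.
have sW : \forall y \near p a, W (s y (r a)) by exact: cs.
have UU : \forall y \near p a, U y.
  by apply: open_nbhs_nbhs; split=> //; exact: (chart_open ch).
apply: filterS2 sW UU => y Wy Uy; exists (s y (r a)) => //.
exact: (chart_proj ch Uy (chart_dom ch Ua)).
Qed.

(** Nearby values of [f] and of [g] keep their fibre coordinates in a chart, so
    that agreement and disagreement at [y] both persist near [y]: the set where
    [f] and [g] agree is open and closed. *)
Lemma lift_unique (Y : topologicalType) (f g : Y -> E) y0 :
  connected [set: Y] -> continuous f -> continuous g ->
  (forall y, p (f y) = p (g y)) -> f y0 = g y0 -> f =1 g.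
Proof.
move=> cY cf cg pfg fg0.
suff agree : [set y | f y = g y] = setT.
  by move=> y; rewrite -[_ = _]/([set y | f y = g y] y) agree.
have dich y :
    exists2 W, nbhs y W & forall z, W z -> (f z = g z) <-> (f y = g y).
  have [U [r [s [Ua ch]]]] := covering_chart covp (p (f y)).
  have Ub : U (p (g y)) by rewrite -pfg.
  exists (f @^-1` (p @^-1` U `&` [set b | r b = r (f y)]) `&`
    g @^-1` [set b | r b = r (g y)]).
    apply: filterI; [apply: cf|apply: cg; exact: (chart_near ch)].
    apply: filterI; last exact: (chart_near ch).
    apply: (covering_continuous covp); apply: open_nbhs_nbhs.
    by split=> //; exact: (chart_open ch).
  move=> z [[/= Uz rf] rg]; split=> [fgz|fgy].
    by rewrite -(chart_coordK ch Ua) -rf fgz rg pfg (chart_coordK ch Ub).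
  have Ugz : U (p (g z)) by rewrite -pfg.
  by rewrite -(chart_coordK ch Uz) -(chart_coordK ch Ugz) rf rg fgy pfg.
apply: cY; first by exists y0.
- exists [set y | f y = g y]; rewrite ?setTI // openE => y /= fgy.
  by have [W Wy WE] := dich y; apply: filterS Wy => z /WE H; apply/H.
- exists [set y | f y = g y]; rewrite ?setTI // -[X in closed X]setCK.
  apply: open_closedC; rewrite openE => y /= fgy.
  by have [W Wy WE] := dich y; apply: filterS Wy => z /WE H /H.
Qed.

End CoveringTheory.

(** Near [b], the preimage of [c] under [f] is forced to be the point of a small
    neighbourhood of [g b] lying over [v c], because [v] is injective near [b];
    such a point exists because [u] is open. *)
Lemma homeomorphism_over (S T Y : topologicalType) (u : S -> Y) (v : T -> Y)
    (f : S -> T) :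
  open_map u -> continuous v -> locally_injective v ->
  (forall a, v (f a) = u a) -> continuous f -> bijective f ->
  homeomorphism f.
Proof.
move=> ou cv iv vf cf [g fg gf]; split=> //; exists g; split=> // b W Wb.
have [V Vb iV] := iv b; rewrite -(gf b) in Vb.
have Q := ou _ _ (filterI Wb (cf _ _ Vb)).
rewrite -vf gf in Q; rewrite gf in Vb.
have {}Q : nbhs b (v @^-1` (u @` (W `&` f @^-1` V))) by apply: cv; exact: Q.
rewrite -/(nbhs b (g @^-1` W)).
apply: filterS2 Vb Q => c Vc [a [Wa Va] uac].
suff <- : f a = c by rewrite /= fg.
by apply: iV; rewrite ?inE // vf.
Qed.

Lemma inj_surj_bij (S T : Type) (f : S -> T) :
  injective f -> (forall b, exists a, f a = b) -> bijective f.
Proof.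
move=> fi fs; pose g b := sval (cid (fs b)).
have gK : cancel g f by move=> b; exact: (svalP (cid (fs b))).
by exists g => // a; apply: fi; rewrite gK.
Qed.

Section Pullbacks.
Variables (Y X : topologicalType) (q : Y -> X) (z : fibred_magma X).
Hypothesis cq : continuous q.

Lemma pullback_val_inj (u v : pullback_space q z) :
  (val u).1 = (val v).1 -> (val u).2 = (val v).2 -> u = v.
Proof.
move=> h1 h2; apply: val_inj.
by case: (val u) (val v) h1 h2 => [? ?] [? ?] /= -> ->.
Qed.

Lemma pullbackP (u : pullback_space q z) : q (val u).1 = bproj (val u).2.
Proof. exact: (set_valP u). Qed.

Lemma pullback_lift y a : q y = bproj a ->
  exists u : pullback_space q z, val u = (y, a).
Proof.
by move=> qy; exact: (@set_type_lift _ [set u : Y * z | q u.1 = bproj u.2] (y, a)).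
Qed.

Lemma pullback_proj_continuous : continuous (@pullback_proj Y X q z).
Proof.
move=> u.
apply: (@continuous_comp (pullback_space q z) (Y * z)%type Y val fst);
  last exact: cvg_fst.
exact: set_val_continuous.
Qed.

Lemma pullback_proj2_continuous :
  continuous (fun u : pullback_space q z => (val u).2).
Proof.
move=> u.
apply: (@continuous_comp (pullback_space q z) (Y * z)%type z val snd);
  last exact: cvg_snd.
exact: set_val_continuous.
Qed.

Lemma pullback_covering :
  covering (@bproj X z) -> covering (@pullback_proj Y X q z).
Proof.
move=> covz; apply: covering_of_charts; first exact: pullback_proj_continuous.
move=> y0; have [U [r [s [Ux ch]]]] := covering_chart covz (q y0).
have pq (e : pullback_space q z) : (val e).1 = y0 -> bproj (val e).2 = q y0.
  by move=> <-; rewrite pullbackP.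
(* Coordinates are taken in the fibre of the pullback over [y0]; the default
   values of [insubd] occur only outside the preimage of [U]. *)
pose R (u : pullback_space q z) : pullback_space q z :=
  insubd u (y0, r (val u).2).
pose S y (e : pullback_space q z) : pullback_space q z :=
  insubd e (y, s (q y) (val e).2).
have UR (u : pullback_space q z) :
    U (q (val u).1) -> val (R u) = (y0, r (val u).2).
  move=> Uu; apply: insubdK; apply/mem_set => /=.
  by rewrite (chart_dom ch) // -pullbackP.
have US y (e : pullback_space q z) : U (q y) -> (val e).1 = y0 ->
    val (S y e) = (y, s (q y) (val e).2).
  move=> Uy ey0; apply: insubdK; apply/mem_set => /=.
  by rewrite (chart_proj ch) //; exact: pq.
exists (pullback_space q z), (q @^-1` U), [set e | (val e).1 = y0], R, S.
split=> //; split.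
- by move/continuousP: cq; apply; exact: (chart_open ch).
- by move=> y e Uy De; rewrite /pullback_proj US.
- move=> y e Uy De; have pe := pq _ De.
  have Uy' : U (q (val (S y e)).1) by rewrite US.
  apply: pullback_val_inj; rewrite UR //= US //=.
  by rewrite (chart_sectK ch).
- by move=> u Uu /=; rewrite UR.
- move=> u Uu; have Ru : (val (R u)).1 = y0 by rewrite UR.
  apply: pullback_val_inj; rewrite US //= UR //= pullbackP (chart_coordK ch) //.
  by rewrite -pullbackP.
- move=> u Uu; have Uu2 : U (bproj (val u).2) by rewrite -pullbackP.
  have N1 : \forall v \near u, r (val v).2 = r (val u).2.
    exact: (pullback_proj2_continuous (chart_near ch Uu2)).
  have N2 : \forall v \near u, U (q (val v).1).
    have c : {for u, continuous (q \o @pullback_proj Y X q z)}.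
      by apply: continuous_comp; [exact: pullback_proj_continuous | exact: cq].
    by apply: c; apply: open_nbhs_nbhs; split=> //; exact: (chart_open ch).
  by apply: filterS2 N1 N2 => v rv Uv; apply: val_inj; rewrite !UR // rv.
- move=> y e Uy De; have pe := pq _ De.
  suff c : {for y, continuous (fun y' => val (S y' e))}.
    move=> W [_ [[V oV <-]] Vy VW]; have := c V; rewrite /= in Vy *.
    move=> cV; have {}cV : \forall y' \near y, V (val (S y' e)).
      by apply: cV; exact: open_nbhs_nbhs.
    by apply: filterS cV => y' Vy'; exact: VW.
  have c : {for y, continuous (fun y' => (y', s (q y') (val e).2))}.
    apply: continuous_pair; first exact: cvg_id.
    apply: (@continuous_comp _ _ _ q (s ^~ (val e).2)); first exact: cq.
    exact: (chart_cvg ch Uy pe).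
  have N : \forall y' \near y, U (q y').
    by apply: cq; apply: open_nbhs_nbhs; split=> //; exact: (chart_open ch).
  have cS : val (S y' e) @[y' --> y] --> (y, s (q y) (val e).2).
    apply: cvg_trans c; apply: near_eq_cvg.
    by apply: filterS N => y' Uy'; rewrite US.
  by rewrite -US in cS.
Qed.

End Pullbacks.

(** In a product with a discrete space, the sections through a point are given
    by keeping the second coordinate. *)
Lemma simply_connected_section (Y E : topologicalType) (p : E -> Y) e :
  simply_connected Y -> covering p ->
  exists s : Y -> E, [/\ continuous s, forall y, p (s y) = y & s (p e) = e].
Proof.
move=> sY /sY[F [h [[ch [g [hg gh cg]]] ph]]].
exists (fun y => g (y, (h e).2)); split.
- move=> y; apply: (@continuous_comp _ _ _ (fun y => (y, (h e).2)) g); last exact: cg.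
  by apply: continuous_pair; [exact: cvg_id | exact: cst_continuous].
- by move=> y; rewrite -ph gh.
- by rewrite -ph -surjective_pairing hg.
Qed.

(** A lift of [q] is a section of the pullback of [p], which is a trivial
    covering. *)
Lemma simply_connected_lift (Y X E : topologicalType) (q : Y -> X) (p : E -> X)
    y0 e :
  simply_connected Y -> continuous q -> covering p -> q y0 = p e ->
  exists s : Y -> E, [/\ continuous s, forall y, p (s y) = q y & s y0 = e].
Proof.
move=> sY cq covp qy0; pose z := FibredMagma p (fun a _ => a).
have [u uE] := @pullback_lift _ _ q z y0 e qy0.
have [s [cs ps su]] :=
  simply_connected_section u sY (@pullback_covering _ _ q z cq covp).
exists (fun y => (val (s y)).2); split.
- move=> y.
  apply: (@continuous_comp _ _ _ s (fun v : pullback_space q z => (val v).2)).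
    exact: cs.
  exact: (@pullback_proj2_continuous _ _ q z).
- by move=> y; rewrite -[p _](pullbackP (s y)); congr q; exact: ps.
- have /= := su; rewrite /pullback_proj uE /= => ->; by rewrite uE.
Qed.

(** * Isomorphisms of group coverings *)

Lemma covering_iso_refl (X : topologicalType) (z : fibred_magma X) :
  covering_iso z z.
Proof.
exists id; split=> //; split; first by move=> x; exact: cvg_id.
by exists id; split=> // x; exact: cvg_id.
Qed.

Lemma covering_iso_sym (X : topologicalType) (z z' : fibred_magma X) :
  covering_iso z z' -> covering_iso z' z.
Proof.
move=> [f [[cf [g [fg gf cg]]] pf mf]]; exists g.
have pg a : bproj (g a) = bproj a by rewrite -pf gf.
split=> //; first by split=> //; exists f.
by move=> a b ab; apply: (can_inj fg); rewrite gf mf ?pg // !gf.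
Qed.

Lemma covering_iso_trans (X : topologicalType) (z' z z'' : fibred_magma X) :
  covering_iso z z' -> covering_iso z' z'' -> covering_iso z z''.
Proof.
move=> [f [[cf [g [fg gf cg]]] pf mf]].
move=> [f' [[cf' [g' [fg' gf' cg']]] pf' mf']].
exists (f' \o f); split.
- split; first by move=> x; apply: continuous_comp; [exact: cf|exact: cf'].
  exists (g \o g'); split; [exact: can_comp|exact: can_comp|].
  by move=> x; apply: continuous_comp; [exact: cg'|exact: cg].
- by move=> a /=; rewrite pf' pf.
- by move=> a b ab /=; rewrite mf // mf' // !pf.
Qed.

(** * The deck group of the universal covering *)

Section Universal.
Variables (X Xt : topologicalType) (q : Xt -> X).
Hypothesis X_connected : connected [set: X].
Hypothesis q_universal : universal_covering q.

Lemma universal_is_covering : covering q. Proof. by case: q_universal. Qed.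

Lemma universal_continuous : continuous q.
Proof. exact: covering_continuous universal_is_covering. Qed.

Lemma universal_total_connected : connected [set: Xt].
Proof. by case: q_universal. Qed.

Lemma universal_simply_connected : simply_connected Xt.
Proof. by case: q_universal. Qed.

(** The image of [q] is open, and so is its complement: over the domain of a
    chart, all fibres are empty as soon as one is. *)
Lemma universal_surjective x : exists xi, q xi = x.
Proof.
have oq : open (range q).
  rewrite openE => _ [xi _ <-].
  exact: (covering_open_map universal_is_covering (@filterT _ (nbhs xi) _)).
suff rq : range q = setT by have [xi _ <-] : range q x; [rewrite rq|exists xi].
have [_ [xi0 _] _ _] := q_universal.
apply: X_connected; first by exists (q xi0), xi0.
  by exists (range q); rewrite ?setTI.
exists (range q); rewrite ?setTI // -[X in closed X]setCK.
apply: open_closedC; rewrite openE => y /= ny.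
have [U [r [s [Uy ch]]]] := covering_chart universal_is_covering y.
have UU : \forall y' \near y, U y'.
  by apply: open_nbhs_nbhs; split=> //; exact: (chart_open ch).
apply: filterS UU => y' Uy' [xi _ xiy']; apply: ny.
by exists (r xi) => //; apply: (chart_dom ch); rewrite xiy'.
Qed.

Lemma deck_continuous (f : deck q) : continuous (deck_fun f).
Proof. by have [[]] := deckP f. Qed.

Lemma deck_proj (f : deck q) xi : q (deck_fun f xi) = q xi.
Proof. by have [_] := deckP f. Qed.

Lemma deckVK (f : deck q) : cancel (deck_fun f) (deck_fun f^-1).
Proof.
by move=> xi; have := congr1 (fun g => deck_fun g xi) (mulVg f).
Qed.

Lemma deck_free (f g : deck q) xi : deck_fun f xi = deck_fun g xi -> f = g.
Proof.
move=> fg; apply: deck_eqP.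
have pfg y : q (deck_fun f y) = q (deck_fun g y) by rewrite !deck_proj.
exact: (lift_unique universal_is_covering universal_total_connected
  (@deck_continuous f) (@deck_continuous g) pfg fg).
Qed.

(** A self-lift of [q] sending [xi] to [eta] and one sending [eta] to [xi] are
    mutually inverse, as both composites are lifts of [q] with a fixed point. *)
Lemma deck_transitive xi eta :
  q xi = q eta -> exists f : deck q, deck_fun f xi = eta.
Proof.
move=> qe.
have lift := simply_connected_lift universal_simply_connected
  universal_continuous universal_is_covering.
have [f [cf qf fxi]] := lift _ _ qe.
have [g [cg qg geta]] := lift _ _ (esym qe).
have inverse (h k : Xt -> Xt) x : continuous h -> continuous k ->
    (forall y, q (h y) = q y) -> (forall y, q (k y) = q y) ->
    k (h x) = x -> cancel h k.
  move=> ch ck qh qk kh.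
  apply: (lift_unique (g := id) universal_is_covering
    universal_total_connected _ _ _ kh).
  - by move=> y; apply: continuous_comp; [exact: ch|exact: ck].
  - by move=> y; exact: cvg_id.
  - by move=> y; rewrite qk qh.
have dP : homeomorphism f /\ forall y, q (f y) = q y.
  split=> //; split=> //; exists g; split=> //.
    by apply: (inverse _ _ xi) => //; rewrite fxi.
  by apply: (inverse _ _ eta) => //; rewrite geta.
by exists (SigSub (mem_set dP) : deck q).
Qed.

(** * The quotient of the product by the deck group *)

Section AssociatedTheory.
Variables (Gam : groupType) (phi : {multiplicative deck q -> autg Gam}).
Local Notation XG := (Xt * discrete_topology Gam)%type.
Local Notation cls xi g := (@assoc_class Xt X q Gam phi (xi, g : Gam)).

Lemma assoc_class_eq u v :
  assoc_class phi u = assoc_class phi v <-> exists f, v = tau phi f u.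
Proof.
split=> [/eqmodP/asboolP //|uv]; apply/eqmodP; exact/asboolP.
Qed.

Lemma assoc_class_surj (a : associated phi) : exists u, a = assoc_class phi u.
Proof. by exists (repr a); rewrite /assoc_class reprK. Qed.

Lemma assoc_class_deck f xi g :
  cls (deck_fun f xi) (autg_fun (phi f) g) = cls xi g.
Proof. by apply/esym/assoc_class_eq; exists f. Qed.

Lemma bproj_class u : @bproj X (associated phi) (assoc_class phi u) = q u.1.
Proof.
rewrite /= /assoc_proj.
have : assoc_class phi (repr (assoc_class phi u)) = assoc_class phi u.
  by rewrite /assoc_class reprK.
by move/assoc_class_eq => [f uE]; rewrite [in RHS]uE /= deck_proj.
Qed.

(** The deck group acts freely on [Xt]. *)
Lemma assoc_class_inj xi g h : cls xi g = cls xi h -> g = h.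
Proof.
move/assoc_class_eq => [f [fxi ->]].
have -> : f = 1 by apply: (@deck_free _ _ xi); rewrite -fxi.
exact: (esym (congr1 snd (tau1 phi (xi, g : discrete_topology Gam)))).
Qed.

(** The deck group acts transitively on the fibres of [q]. *)
Lemma assoc_class_over xi (a : associated phi) :
  q xi = bproj a -> exists g, a = cls xi g.
Proof.
have [[eta g] ->] := assoc_class_surj a; rewrite bproj_class /= => qe.
have [f fe] := deck_transitive (esym qe).
by exists (autg_fun (phi f) g); rewrite -fe assoc_class_deck.
Qed.

(** If [(xi, g)] and [(xi, h)] are moved to points with the same first coordinate,
    it is by the same deck transformation [f], as the action on [Xt] is free; and
    [phi f] is a group morphism. *)
Lemma fmul_class xi g h :
  @fmul X (associated phi) (cls xi g) (cls xi h) = cls xi (g * h).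
Proof.
rewrite -[LHS]/(assoc_mul (cls xi g) (cls xi h)) /assoc_mul.
apply: xget_unique; first by exists xi, g, h.
move=> c [eta [g' [h' [/esym eg /esym eh ->]]]].
move: eg eh => /assoc_class_eq[f [fe ->]] /assoc_class_eq[k [ke ->]].
have -> : k = f by apply: (@deck_free _ _ eta); rewrite -ke.
have [_ mf] := autgP (phi f).
by rewrite -mf fe assoc_class_deck.
Qed.

Lemma assoc_class_continuous : continuous (assoc_class phi).
Proof. exact: pi_continuous. Qed.

Lemma assoc_class_cst_continuous g : continuous (fun xi => cls xi g).
Proof.
move=> xi; apply: (@continuous_comp _ XG _ (fun xi => (xi, g)) (assoc_class phi)).
  by apply: continuous_pair; [exact: cvg_id|exact: cst_continuous].
exact: assoc_class_continuous.
Qed.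

Lemma assoc_continuous (Z : topologicalType) (k : associated phi -> Z) :
  (forall g, continuous (fun xi => k (cls xi g))) -> continuous k.
Proof.
move=> ck; apply/quotient_continuous.
exact: (@continuous_of_fibrewise _ _ Gam (k \o assoc_class phi)).
Qed.

Lemma tau_continuous f : continuous (tau phi f).
Proof.
apply: (@continuous_of_fibrewise _ _ Gam) => g xi.
apply: continuous_pair; [exact: deck_continuous|exact: cst_continuous].
Qed.

(** The saturation of an open set is the union of its preimages under the
    homeomorphisms [tau phi f]. *)
Lemma assoc_class_open_map : open_map (assoc_class phi).
Proof.
move=> u W; rewrite nbhsE => -[V [oV Vu] VW].
apply: (@filterS _ _ _ (assoc_class phi @` V)); first exact: image_subset.
apply: open_nbhs_nbhs; split; last by exists u.
rewrite /open /= /quotient_open.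
have -> : \pi_(quotient_topology {eq_quot (tau_equiv phi)})%qT
    @^-1` (assoc_class phi @` V) = \bigcup_f (tau phi f @^-1` V).
  apply/seteqP; split=> [v [w Vw /esym/assoc_class_eq[f wv]]|v [f _ Vv]].
    by exists f => //=; rewrite -wv.
  by exists (tau phi f v) => //; apply/esym/assoc_class_eq; exists f.
by apply: bigcup_open => f _; move/continuousP: (@tau_continuous f); exact.
Qed.

Lemma bproj_continuous : continuous (@bproj X (associated phi)).
Proof.
apply: assoc_continuous => g.
have -> : (fun xi => bproj (cls xi g : associated phi)) = q.
  by apply/funext => xi; rewrite bproj_class.
exact: universal_continuous.
Qed.
End AssociatedTheory.
End Universal.

(** * Group coverings *)

Section GroupCoverings.
Variables (X : topologicalType) (z : fibred_magma X).
Hypothesis gz : group_covering z.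

Lemma group_covering_covering : covering (@bproj X z).
Proof.
have [cp dp _ tp] := gz; split=> // x; have [U [oU Ux [h [th _]]]] := tp x.
by exists U; split=> //; exists h.
Qed.

Lemma bproj_fmul (a b : z) : bproj a = bproj b -> bproj (fmul a b) = bproj a.
Proof.
have [_ _ gp _] := gz => ab; have [G [i [[j ij ji] iM]]] := gp (bproj a).
have fibE c : bproj c = bproj a -> exists g, val (i g) = c.
  move=> ca; have [e <-] : exists e : fibre (@bproj X z) (bproj a), val e = c.
    exact: set_type_lift.
  by exists (j e); rewrite ji.
have [g ga] := fibE a erefl; have [h hb] := fibE b (esym ab).
by rewrite -{1}ga -hb -iM; exact: (set_valP (i (g * h))).
Qed.

(** In a chart compatible with the laws, the product of two sections with locally
    constant coordinates has as coordinate the product of these coordinates. *)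
Lemma fmul_continuous (Y : topologicalType) (f g : Y -> z) :
  continuous f -> continuous g -> (forall y, bproj (f y) = bproj (g y)) ->
  continuous (fun y => fmul (f y) (g y)).
Proof.
move=> cf cg fg y; have [cp dp _ tp] := gz.
have [U [oU Ux [h [th hM]]]] := tp (bproj (f y)).
have [r [s [ch rh]]] := chart_of_trivialization cp dp oU Ux th.
have rM a b : U (bproj a) -> bproj a = bproj b -> r (fmul a b) = fmul (r a) (r b).
  move=> Ua ab.
  have [a' aE] : exists a' : set_type (@bproj X z @^-1` U), val a' = a.
    exact: set_type_lift.
  have [b' bE] : exists b' : set_type (@bproj X z @^-1` U), val b' = b.
    by apply: set_type_lift; rewrite /= -ab.
  have [c' cE] : exists c' : set_type (@bproj X z @^-1` U), val c' = fmul a b.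
    by apply: set_type_lift; rewrite /= bproj_fmul.
  by rewrite -cE -aE -bE !rh; apply: hM; rewrite ?aE ?bE ?cE.
have NU : \forall y' \near y, U (bproj (f y')).
  have c : {for y, continuous (@bproj X z \o f)}.
    by apply: continuous_comp; [exact: cf | exact: cp].
  by apply: c; apply: open_nbhs_nbhs; split.
have Nf : \forall y' \near y, r (f y') = r (f y).
  exact: (cf _ _ (chart_near ch Ux)).
have Ux' : U (bproj (g y)) by rewrite -fg.
have Ng : \forall y' \near y, r (g y') = r (g y).
  exact: (cg _ _ (chart_near ch Ux')).
pose e := fmul (r (f y)) (r (g y)).
have De : bproj e = bproj (f y).
  have rf : bproj (r (f y)) = bproj (f y) := chart_dom ch Ux.
  rewrite /e bproj_fmul // rf; rewrite fg in Ux ch *.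
  exact: (esym (chart_dom ch Ux)).
have c : {for y, continuous (fun y' => s (bproj (f y')) e)}.
  apply: (@continuous_comp _ _ _ (@bproj X z \o f) (s ^~ e)).
    by apply: continuous_comp; [exact: cf | exact: cp].
  exact: (chart_cvg ch Ux De).
have E y' : U (bproj (f y')) -> r (f y') = r (f y) -> r (g y') = r (g y) ->
    s (bproj (f y')) e = fmul (f y') (g y').
  move=> Uy rf rg; have bM := bproj_fmul (fg y').
  by rewrite /e -rf -rg -rM // -bM (chart_coordK ch) // bM.
have c' : s (bproj (f y')) e @[y' --> y] --> fmul (f y) (g y).
  by rewrite -E.
apply: cvg_trans c'; apply: near_eq_cvg.
by apply: filterS3 NU Nf Ng => y' *; exact: E.
Qed.

End GroupCoverings.

(** * Parametrizations of group coverings *)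

(** The same data as an isomorphism of the trivial bundle with group [Gam] to the
    pullback of [z] along [q], in the form of a family of lifts of [q]. *)
Record fibre_param (Xt X : topologicalType) (q : Xt -> X) (Gam : groupType)
    (z : fibred_magma X) (m : Xt -> Gam -> z) : Prop := FibreParam {
  param_proj : forall xi g, bproj (m xi g) = q xi;
  param_continuous : forall g, continuous (m ^~ g);
  param_inj : forall xi, injective (m xi);
  param_surj : forall xi a, q xi = bproj a -> exists g, m xi g = a;
  paramM : forall xi g h, m xi (g * h) = fmul (m xi g) (m xi h)
}.

Definition equivariant (Xt X : topologicalType) (q : Xt -> X) (Gam : groupType)
    (phi : {multiplicative deck q -> autg Gam}) (Z : Type)
    (m : Xt -> Gam -> Z) :=
  forall f xi g, m (deck_fun f xi) (autg_fun (phi f) g) = m xi g.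

Section Parametrizations.
Variables (X Xt : topologicalType) (q : Xt -> X).
Hypothesis q_universal : universal_covering q.

(** The comparison of [m] with [m'] over one point [xi0] gives [lam]; for each
    [g], the lifts [m ^~ g] and [m' ^~ (lam g)] of [q] agree at [xi0]. *)
Lemma param_unique (Gam : groupType) (z : fibred_magma X)
    (m m' : Xt -> Gam -> z) :
  covering (@bproj X z) -> fibre_param q m -> fibre_param q m' ->
  exists lam : autg Gam, forall xi g, m xi g = m' xi (autg_fun lam g).
Proof.
move=> covz pm pm'; have [_ [xi0 _] cXt _] := q_universal.
have ex g : exists h, m' xi0 h = m xi0 g.
  by apply: (param_surj pm'); rewrite (param_proj pm).
have ex' h : exists g, m xi0 g = m' xi0 h.
  by apply: (param_surj pm); rewrite (param_proj pm').
pose lam g := sval (cid (ex g)).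
have lam0 g : m' xi0 (lam g) = m xi0 g by exact: (svalP (cid (ex g))).
have lamP : bijective lam /\ {morph lam : g h / g * h}.
  split; last first.
    move=> g h; apply: (param_inj pm' (xi := xi0)).
    by rewrite (paramM pm') !lam0 (paramM pm).
  apply: inj_surj_bij => [g h gh|h].
    by apply: (param_inj pm (xi := xi0)); rewrite -!lam0 gh.
  have [g gh] := ex' h; exists g.
  by apply: (param_inj pm' (xi := xi0)); rewrite lam0.
exists (SigSub (mem_set lamP) : autg Gam) => xi g.
have pmm y : bproj (m y g) = bproj (m' y (lam g)).
  by rewrite (param_proj pm) (param_proj pm').
exact: (lift_unique covz cXt (param_continuous pm (g := g))
  (param_continuous pm' (g := lam g)) pmm (esym (lam0 g))).
Qed.

Lemma param_comp_deck (Gam : groupType) (z : fibred_magma X)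
    (m : Xt -> Gam -> z) (f : deck q) :
  fibre_param q m -> fibre_param q (fun xi => m (deck_fun f xi)).
Proof.
move=> pm; split.
- by move=> xi g; rewrite (param_proj pm) deck_proj.
- move=> g xi; apply: (@continuous_comp _ _ _ (deck_fun f) (m ^~ g)).
    exact: deck_continuous.
  exact: (param_continuous pm).
- by move=> xi; exact: (param_inj pm).
- by move=> xi a qa; apply: (param_surj pm); rewrite deck_proj.
- by move=> xi g h; exact: (paramM pm).
Qed.

(** [phi f] is the automorphism that compares [m] with its translate by [f^-1];
    the inverse makes [phi] a morphism and not an anti-morphism. *)
Lemma param_equivariant (Gam : groupType) (z : fibred_magma X)
    (m : Xt -> Gam -> z) :
  covering (@bproj X z) -> fibre_param q m ->
  exists phi : {multiplicative deck q -> autg Gam}, equivariant phi m.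
Proof.
move=> covz pm; have [_ [xi0 _] _ _] := q_universal.
have ex f := param_unique covz (param_comp_deck f^-1 pm) pm.
pose lam f := sval (cid (ex f)).
have lamE f xi g : m (deck_fun f^-1 xi) g = m xi (autg_fun (lam f) g).
  exact: (svalP (cid (ex f))).
have lamM : {morph lam : f g / f * g}.
  move=> f g; apply: autg_eqP => a; apply: (param_inj pm (xi := xi0)).
  by rewrite -lamE invgM [RHS]/= -!lamE.
pose phi : {multiplicative deck q -> autg Gam} :=
  HB.pack lam (isMultiplicative.Build (deck q) (autg Gam) lam lamM).
by exists phi => f xi g; rewrite -lamE deckVK.
Qed.

Lemma trivial_iso_of_param (Gam : groupType) (z : fibred_magma X)
    (m : Xt -> Gam -> z) :
  covering (@bproj X z) -> fibre_param q m ->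
  covering_iso (trivial_bundle Xt Gam) (pullback q z).
Proof.
move=> covz pm.
have cq := universal_continuous q_universal.
pose XG : topologicalType := (Xt * discrete_topology Gam)%type.
have fP (u : XG) : [set u : Xt * z | q u.1 = bproj u.2] (u.1, m u.1 u.2).
  by rewrite /= (param_proj pm).
pose f (u : XG) : pullback_space q z := SigSub (mem_set (fP u)).
have cf : continuous f.
  apply: continuous_set_type.
  apply: (@continuous_of_fibrewise _ _ Gam (val \o f)) => g xi.
  have c : {for xi, continuous (fun xi => (xi, m xi g))}.
    by apply: continuous_pair; [exact: cvg_id | exact: (param_continuous pm)].
  exact: c.
have bf : bijective f.
  apply: inj_surj_bij => [[xi g] [eta h]|u].
    by move=> /(congr1 val)[/= <-] /(param_inj pm) ->.
  have [g gE] := param_surj pm (pullbackP u).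
  by exists ((val u).1, g); apply: pullback_val_inj.
exists f; split=> //.
  apply: (@homeomorphism_over _ _ _ fst (@pullback_proj Xt X q z)) => //.
  - exact: fst_open_map.
  - exact: pullback_proj_continuous.
  - exact: (covering_locally_injective (pullback_covering cq covz)).
move=> [xi g] [_ h] /= <-; apply: val_inj.
rewrite [LHS]/= (paramM pm) insubdK //; apply/mem_set.
by have := param_proj pm xi (g * h); rewrite (paramM pm) /= => ->.
Qed.

Lemma param_of_trivial_iso (Gam : groupType) (z : fibred_magma X) :
  group_covering z -> covering_iso (trivial_bundle Xt Gam) (pullback q z) ->
  exists m : Xt -> Gam -> z, fibre_param q m.
Proof.
move=> gz [F [[cF [G [FG GF cG]]] pF mF]].
have pF1 xi (g : Gam) : (val (F (xi, g))).1 = xi by exact: (pF (xi, g)).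
exists (fun xi g => (val (F (xi, g))).2); split.
- by move=> xi g; rewrite -pullbackP pF1.
- move=> g xi; apply: (@continuous_comp _ _ _ (fun xi => F (xi, g))
    (fun u : pullback_space q z => (val u).2));
    last exact: (@pullback_proj2_continuous _ _ q z).
  apply: (@continuous_comp _ (Xt * discrete_topology Gam)%type _
    (fun xi => (xi, g)) F); last exact: cF.
  by apply: continuous_pair; [exact: cvg_id | exact: cst_continuous].
- move=> xi g h gh; have : F (xi, g) = F (xi, h).
    by apply: pullback_val_inj; rewrite ?pF1.
  by move/(can_inj FG) => [].
- move=> xi a qa; have [u uE] := pullback_lift qa.
  exists (G u).2; have xiE : (G u).1 = xi.
    by have := pF (G u); rewrite GF /= /pullback_proj uE.
  by rewrite -xiE -surjective_pairing GF uE.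
- move=> xi g h; have := mF (xi, g) (xi, h) erefl => /= ->.
  rewrite insubdK //; apply/mem_set => /=.
  by rewrite (bproj_fmul gz) -?pullbackP ?pF1.
Qed.

(** The parameter group is one fibre, [m ^~ g] the lift of [q] through [g].
    Fibrewise products of such lifts are again lifts, so the group law of one fibre
    determines that of all others. *)
Lemma param_of_group_covering (z : fibred_magma X) : group_covering z ->
  exists (Gam : groupType) (m : Xt -> Gam -> z), fibre_param q m.
Proof.
move=> gz; have [_ [xi0 _] cXt sXt] := q_universal.
have covz := group_covering_covering gz.
have cq := universal_continuous q_universal.
have [_ _ gp _] := gz; have [Gam [i [[j ij ji] iM]]] := gp (q xi0).
have iP g : q xi0 = bproj (val (i g)) by exact: (esym (set_valP (i g))).
have lift g := simply_connected_lift sXt cq covz (iP g).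
pose m xi g := sval (cid (lift g)) xi.
have cm g : continuous (m ^~ g) by have [H _ _] := svalP (cid (lift g)); exact: H.
have pm xi g : bproj (m xi g) = q xi by have [_ H _] := svalP (cid (lift g)); exact: H.
have m0 g : m xi0 g = val (i g) by have [_ _ H] := svalP (cid (lift g)); exact: H.
have uniq (t : Xt -> z) xi g : continuous t -> (forall y, bproj (t y) = q y) ->
    t xi = m xi g -> forall y, t y = m y g.
  move=> ct pt tm; have ptm y : bproj (t y) = bproj (m y g) by rewrite pt pm.
  exact: (lift_unique covz cXt ct (cm g) ptm tm).
exists Gam, m; split=> //.
- move=> xi g h /(uniq (m ^~ g) xi h (cm g) (pm ^~ g)) /(_ xi0).
  by rewrite !m0 => /val_inj /(can_inj ij).
- move=> xi a qa; have [t [ct pt ta]] := simply_connected_lift sXt cq covz qa.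
  have [e eE] : exists e : fibre (@bproj X z) (q xi0), val e = t xi0.
    by apply: set_type_lift; exact: pt.
  exists (j e); rewrite -ta; apply/esym/(uniq t xi0) => //.
  by rewrite m0 ji.
- move=> xi g h; apply/esym.
  have gh y : bproj (m y g) = bproj (m y h) by rewrite !pm.
  apply: (uniq (fun y => fmul (m y g) (m y h)) xi0 (g * h)).
  + exact: fmul_continuous.
  + by move=> y; rewrite bproj_fmul.
  + by rewrite !m0 iM.
Qed.

End Parametrizations.

(** * Group coverings associated with an action on the fibre *)

Section AssociatedCoverings.
Variables (X Xt : topologicalType) (q : Xt -> X).
Hypothesis X_connected : connected [set: X].
Hypothesis q_universal : universal_covering q.
Variable Gam : groupType.

Section OneAction.
Variable phi : {multiplicative deck q -> autg Gam}.
Local Notation cls xi g := (@assoc_class Xt X q Gam phi (xi, g : Gam)).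

Lemma assoc_param :
  fibre_param q (fun xi (g : Gam) => cls xi g : associated phi).
Proof.
split.
- by move=> xi g; rewrite bproj_class.
- exact: assoc_class_cst_continuous.
- by move=> xi g h; exact: assoc_class_inj.
- by move=> xi a /(assoc_class_over q_universal)[g ->]; exists g.
- by move=> xi g h; rewrite fmul_class.
Qed.

Lemma assoc_equivariant :
  equivariant phi (fun xi (g : Gam) => cls xi g : associated phi).
Proof. by move=> f xi g; exact: assoc_class_deck. Qed.

(** A chart of [q] provides a local section [sg] of [q] near [x]; the classes with
    representatives over [sg y] form the fibre over [y], with coordinates in
    [Gam]. *)
Lemma assoc_chart x : exists (U : set X) (R : associated phi -> Gam) S,
  [/\ U x, chart (@bproj X (associated phi)) U setT R S &
    forall y g h, fmul (S y g) (S y h) = S y (g * h)].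
Proof.
have [xi0 xi0x] := universal_surjective X_connected q_universal x.
have [U [r [s [Ux ch]]]] := covering_chart (universal_is_covering q_universal) x.
have De : (q @^-1` [set x]) (r xi0) by apply: (chart_dom ch); rewrite xi0x.
pose sg y := s y (r xi0).
have qsg y : U y -> q (sg y) = y by move=> Uy; exact: (chart_proj ch).
pose S y g : associated phi := cls (sg y) g.
pose R (a : associated phi) : Gam := xget 1 [set g | a = S (bproj a) g].
have RK a : U (bproj a) -> S (bproj a) (R a) = a.
  move=> Ua; have [g ag] : exists g, a = S (bproj a) g.
    by apply: (assoc_class_over q_universal); rewrite qsg.
  by rewrite /R; case: xgetP => [h _ /= <-//|/(_ g)].
have SR y g : U y -> bproj (S y g) = y by move=> Uy; rewrite bproj_class /= qsg.
have RS y g : U y -> R (S y g) = g.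
  move=> Uy; have := RK (S y g); rewrite SR // => /(_ Uy).
  exact: assoc_class_inj.
exists U, R, S; split=> //; last by move=> y g h; rewrite fmul_class.
split=> //.
- exact: (chart_open ch).
- by move=> y g Uy _; exact: SR.
- by move=> y g Uy _; exact: RS.
(* The points of the quotient near [a] are the classes of points [(eta, g)] with
   [eta] near [sg (bproj a)], and these [eta] belong to the image of [sg]. *)
- move=> a Ua; pose g := R a; pose xi := sg (bproj a).
  have Uxi : U (q xi) by rewrite qsg.
  have rxi : r xi = r xi0 by exact: (chart_sectK ch).
  have N1 : \forall u \near (xi, g : discrete_topology Gam), u.2 = g.
    by apply: (@cvg_snd _ _ _ _ _ [set g]); exact: discrete_set1.
  have N2 : \forall u \near (xi, g : discrete_topology Gam), r u.1 = r xi0.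
    rewrite -rxi; apply: (@cvg_fst _ _ _ _ _ [set eta | r eta = r xi]).
    exact: (chart_near ch).
  have N3 : \forall u \near (xi, g : discrete_topology Gam), U (q u.1).
    apply: (@cvg_fst _ _ _ _ _ (q @^-1` U)).
    apply: (universal_continuous q_universal).
    by apply: open_nbhs_nbhs; split=> //; exact: (chart_open ch).
  pose W := [set u : Xt * discrete_topology Gam |
    u.2 = g /\ (r u.1 = r xi0 /\ U (q u.1))].
  have NW : nbhs ((xi, g) : Xt * discrete_topology Gam) W.
    exact: (filterI N1 (filterI N2 N3)).
  have NaW : nbhs (a : associated phi) (assoc_class phi @` W).
    by rewrite -(RK a Ua); exact: assoc_class_open_map NW.
  apply: filterS NaW.
  move=> _ [[eta h] [/= hg [reta Ueta]] <-]; rewrite hg.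
  have -> : eta = sg (q eta) by rewrite /sg -reta (chart_coordK ch).
  exact: RS.
- move=> y g Uy _; apply: (@continuous_comp _ _ _ sg (fun xi => cls xi g)).
    exact: (chart_cvg ch).
  exact: assoc_class_cst_continuous.
Qed.

Lemma associated_group_covering : group_covering (associated phi).
Proof.
have cp := @bproj_continuous _ _ _ q_universal _ phi.
have pm := assoc_param.
split=> //.
- apply: discrete_fibres_of_charts => x.
  have [U [R [S [Ux ch _]]]] := assoc_chart x.
  by exists Gam, U, setT, R, S.
- move=> x; have [xi xix] := universal_surjective X_connected q_universal x.
  have iP (g : Gam) : (@bproj X (associated phi) @^-1` [set x]) (cls xi g).
    by rewrite /= -xix; exact: (param_proj pm).
  pose i (g : Gam) : fibre (@bproj X (associated phi)) x := SigSub (mem_set (iP g)).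
  exists Gam, i; split; last by move=> g h; exact: (paramM pm).
  apply: inj_surj_bij => [g h /(congr1 val)|a]; first exact: (param_inj pm).
  have xa : q xi = bproj (val a) by rewrite xix; exact: (esym (set_valP a)).
  by have [g ga] := param_surj pm xa; exists g; exact: val_inj.
- move=> x; have [U [R [S [Ux ch SM]]]] := assoc_chart x.
  exists U; split=> //; first exact: (chart_open ch).
  have [h [th hE]] := trivialization_of_chart cp ch Ux; exists h; split=> //.
  move=> a b c ab cab; rewrite !hE SM; congr (S x _).
  have Ua : U (bproj (val a)) := set_valP a.
  have Ub : U (bproj (val b)) := set_valP b.
  rewrite cab -{1}(chart_coordK ch Ua) -{1}(chart_coordK ch Ub) -ab SM.
  by rewrite (chart_sectK ch).
Qed.

(** An equivariant [m] is constant on the orbits of the deck group. *)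
Lemma associated_iso_of_param (z : fibred_magma X) (m : Xt -> Gam -> z) :
  covering (@bproj X z) -> fibre_param q m -> equivariant phi m ->
  covering_iso (associated phi) z.
Proof.
move=> covz pm em.
pose k (a : associated phi) : z :=
  let u := repr (a : {eq_quot (tau_equiv phi)})%qT in m u.1 (u.2 : Gam).
have kE xi g : k (cls xi g) = m xi g.
  have : assoc_class phi (repr (cls xi g)) = cls xi g.
    by rewrite /assoc_class reprK.
  rewrite /k; move: (repr _) => u /assoc_class_eq[f [-> ->]].
  by rewrite em.
have am := assoc_param.
have covA := group_covering_covering associated_group_covering.
have over (a : associated phi) xi : q xi = bproj a -> exists g, a = cls xi g.
  by move=> /(param_surj am)[g <-]; exists g.
have pk a : bproj (k a) = bproj a.
  have [[xi g] ->] := assoc_class_surj a.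
  by rewrite kE (param_proj pm) bproj_class.
exists k; split=> //.
  apply: (@homeomorphism_over _ _ _ (@bproj X (associated phi)) (@bproj X z)) => //.
  - exact: covering_open_map.
  - exact: covering_continuous.
  - exact: covering_locally_injective.
  - apply: assoc_continuous => g.
    have -> : (fun xi => k (cls xi g)) = m ^~ g by apply/funext => xi; rewrite kE.
    exact: (param_continuous pm).
  - apply: inj_surj_bij => [a b ab|c].
      have [[xi g] aE] := assoc_class_surj a.
      have [h bE] : exists h, b = cls xi h.
        by apply: over; rewrite -pk -ab pk aE bproj_class.
      by move: ab; rewrite aE bE !kE => /(param_inj pm) ->.
    have [xi xic] := universal_surjective X_connected q_universal (bproj c).
    by have [g gc] := param_surj pm xic; exists (cls xi g); rewrite kE.
move=> a b ab; have [[xi g] aE] := assoc_class_surj a.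
have [h bE] : exists h, b = cls xi h by apply: over; rewrite -ab aE bproj_class.
by rewrite aE bE fmul_class // !kE (paramM pm).
Qed.

End OneAction.

(** Two parametrizations of the covering associated with [phi'] are compared: the
    tautological one and, for the direct implication, the image by the given
    isomorphism of the one of [associated phi]; for the converse, the
    tautological one twisted by [lam], which is equivariant for [phi]. *)
Lemma associated_iso_conjugate (phi phi' : {multiplicative deck q -> autg Gam}) :
  covering_iso (associated phi) (associated phi') <-> conjugate phi phi'.
Proof.
have covA' := group_covering_covering (associated_group_covering phi').
split=> [[F [[cF [G [FG GF cG]]] pF mF]]|[lam lamE]].
  pose m xi (g : Gam) : associated phi' := F (assoc_class phi (xi, g)).
  have am := assoc_param phi; have em := @assoc_equivariant phi.
  have pm : fibre_param q m.
    split.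
    - by move=> xi g; rewrite pF (param_proj am).
    - move=> g xi.
      apply: (@continuous_comp _ _ _ (fun xi => assoc_class phi (xi, g)) F).
        exact: (param_continuous am).
      exact: cF.
    - by move=> xi g h /(can_inj FG) /(param_inj am).
    - move=> xi a qa; have qGa : q xi = bproj (G a) by rewrite -pF GF.
      by have [g ga] := param_surj am qGa; exists g; rewrite /m ga GF.
    - by move=> xi g h; rewrite /m (paramM am) mF // !(param_proj am).
  have [lam lamE] := param_unique q_universal covA' pm (assoc_param phi').
  exists lam => f; apply: autg_eqP => g.
  have [_ [xi0 _] _ _] := q_universal.
  have key h :
      autg_fun lam (autg_fun (phi f) h) = autg_fun (phi' f) (autg_fun lam h).
    apply: (param_inj (assoc_param phi') (xi := deck_fun f xi0)).
    rewrite -lamE [RHS]assoc_class_deck -lamE.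
    by rewrite /m assoc_class_deck.
  have lamV : autg_fun (lam * lam^-1) g = g by rewrite mulgV.
  by rewrite -{1}lamV /= -key.
apply: (@associated_iso_of_param phi (associated phi')
  (fun xi g => assoc_class phi' (xi, autg_fun lam g))) => //.
  have am := assoc_param phi'; have [[k lk kl] lM] := autgP lam.
  split.
  - by move=> xi g; rewrite (param_proj am).
  - by move=> g; exact: (param_continuous am).
  - by move=> xi g h /(param_inj am) /(can_inj lk).
  - by move=> xi a /(param_surj am)[g <-]; exists (k g); rewrite kl.
  - by move=> xi g h; rewrite lM (paramM am).
move=> f xi g.
have -> :
    autg_fun lam (autg_fun (phi f) g) = autg_fun (phi' f) (autg_fun lam g).
  rewrite lamE /= /conj_fun.
  have lamV : autg_fun (lam^-1 * lam) g = g by rewrite mulVg.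
  by rewrite -{1}lamV.
exact: assoc_class_deck.
Qed.

Lemma associated_pi1_group_covering (phi : {multiplicative deck q -> autg Gam}) :
  pi1_group_covering q Gam (associated phi).
Proof.
have gA := associated_group_covering phi; split=> //.
apply: covering_iso_sym.
exact: (trivial_iso_of_param q_universal (group_covering_covering gA)
  (assoc_param phi)).
Qed.

Lemma exists_associated (z : fibred_magma X) (m : Xt -> Gam -> z) :
  group_covering z -> fibre_param q m ->
  exists phi : {multiplicative deck q -> autg Gam},
    covering_iso z (associated phi).
Proof.
move=> /group_covering_covering covz pm.
have [phi em] := param_equivariant q_universal covz pm.
by exists phi; apply: covering_iso_sym; exact: associated_iso_of_param em.
Qed.

Lemma conjugate_refl (phi : {multiplicative deck q -> autg Gam}) :
  conjugate phi phi.
Proof. by apply/associated_iso_conjugate; exact: covering_iso_refl. Qed.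

(** Conjugacy is an equivalence relation because isomorphism of the associated
    coverings is one. *)
Lemma hom_orbit_eq (phi phi' : {multiplicative deck q -> autg Gam}) :
  conjugate phi phi' -> hom_orbit phi = hom_orbit phi'.
Proof.
move=> /associated_iso_conjugate pp'; apply/seteqP.
split=> psi /= /associated_iso_conjugate pp; apply/associated_iso_conjugate;
  apply: covering_iso_trans pp => //.
exact: covering_iso_sym.
Qed.

Lemma iso_class_eq (z z' : fibred_magma X) :
  covering_iso z z' -> iso_class q Gam z = iso_class q Gam z'.
Proof.
move=> zz'; apply/funext => w; apply/propext; split=> -[gw] zw; split=> //.
  exact: (covering_iso_trans (covering_iso_sym zz') zw).
exact: (covering_iso_trans zz' zw).
Qed.

End AssociatedCoverings.

(** * Classification *)

Theorem theorem4p2 (X Xt : topologicalType) (q : Xt -> X)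
    (X_connected : connected [set: X]) (q_universal : universal_covering q) :
  [/\ forall z : fibred_magma X, group_covering z ->
        exists (Gam : groupType) (phi : {multiplicative deck q -> autg Gam}),
          covering_iso z (associated phi),
      forall (Gam : groupType) (phi phi' : {multiplicative deck q -> autg Gam}),
        [/\ group_covering (associated phi),
            group_covering (associated phi') &
            covering_iso (associated phi) (associated phi') <->
            conjugate phi phi']
    & forall Gam : groupType,
        exists F : set {multiplicative deck q -> autg Gam} ->
                   (fibred_magma X -> Prop),
          [/\ forall O, H1 (deck q) Gam O -> is_iso_class q Gam (F O),
              forall O O', H1 (deck q) Gam O -> H1 (deck q) Gam O' ->
                F O = F O' -> O = O',
              forall C, is_iso_class q Gam C ->
                exists2 O, H1 (deck q) Gam O & F O = C
            & forall phi : {multiplicative deck q -> autg Gam},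
                F (hom_orbit phi) = iso_class q Gam (associated phi)]].
Proof.
split=> [z gz|Gam phi phi'|Gam].
- have [Gam [m pm]] := param_of_group_covering q_universal gz.
  by exists Gam; exact: (exists_associated X_connected q_universal gz pm).
- split; [exact: associated_group_covering | exact: associated_group_covering |].
  exact: associated_iso_conjugate.
(* Conjugate morphisms have the same class of coverings, so that [F] takes the
   union over the orbit instead of choosing a representative. *)
pose F (O : set {multiplicative deck q -> autg Gam}) (z : fibred_magma X) :=
  exists2 phi, O phi & iso_class q Gam (associated phi) z.
have conjP phi phi' := associated_iso_conjugate X_connected q_universal phi phi'.
have FE phi : F (hom_orbit phi) = iso_class q Gam (associated phi).
  apply/funext => z; apply/propext; split=> [[psi /conjP phipsi]|zphi].
    by rewrite (iso_class_eq q Gam phipsi).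
  by exists phi => //; exact: (conjugate_refl X_connected q_universal phi).
have pi1 phi := associated_pi1_group_covering X_connected q_universal phi.
exists F; split=> //.
- by move=> _ [phi _ <-]; exists (associated phi); rewrite FE.
- move=> _ _ [phi _ <-] [phi' _ <-]; rewrite !FE => E.
  apply: (hom_orbit_eq X_connected q_universal); apply/conjP.
  suff [] : iso_class q Gam (associated phi) (associated phi') by [].
  by rewrite E; split; [exact: pi1 | exact: covering_iso_refl].
- move=> _ [z [[gz zt] ->]].
  have [m pm] := param_of_trivial_iso gz (covering_iso_sym zt).
  have [phi zphi] := exists_associated X_connected q_universal gz pm.
  exists (hom_orbit phi); first by exists phi.
  by rewrite FE (iso_class_eq q Gam zphi).
Qed.
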